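(* For every integer $n>0$, $$A(n)=B(n)=C(n+1)=\frac{1}{2}D(n+1),$$ where, for a positive integer $m$: \begin{itemize} \item $A(m)$ is the number of partitions of $m$ into distinct parts; \item $B(m)$ is the number of partitions of $m$ into odd parts; \item $C(m)$ is the number of partitions of $m$ whose largest part is even and in which the parts not exceeding half of the largest part are distinct (that is, if the largest part is $2N$, then each integer $j$ with $1\le j\le N$ occurs as a part at most once, while parts greater than $N$ may be repeated); \item $D(m)$ is the number of partitions of $m$ into non-negative parts in which the smallest part appears exactly twice and no other part is repeated. \end{itemize}
   Context: A partition of a positive integer $m$ is a finite multiset of positive integers (called parts) whose sum is $m$. Partitions counted by $A$, $B$ and $C$ have positive parts. A partition of $m$ into non-negative parts is a finite multiset of non-negative integers with sum $m$, so $0$ is allowed as a part (but need not occur) and multiplicities of $0$ are counted. In the definition of $D(m)$, the smallest part is the minimum of this multiset; it may be $0$ (in which case $0$ occurs exactly twice and all positive parts are distinct) or positive (in which case $0$ does not occur). For example, $D(7)=8$, the partitions counted being $0+0+7$, $0+0+6+1$, $0+0+5+2$, $0+0+4+3$, $0+0+4+2+1$, $1+1+5$, $1+1+2+3$, $2+2+3$; and $C(7)=4$, the partitions counted being $6+1$, $4+3$, $4+2+1$, $2+2+2+1$. *)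

(* Defs.v *)
From mathcomp Require Import all_boot all_order all_algebra.
From mathcomp Require Import finmap multiset.
From mathcomp Require Import boolp classical_sets functions cardinality.
Set Implicit Arguments.
Unset Strict Implicit.
Unset Printing Implicit Defensive.

Local Open Scope nat_scope.
Local Open Scope mset_scope.
Local Open Scope classical_set_scope.

(* For p : {mset nat}, p j is the multiplicity of j in p, and big operators
   over p count each part with its multiplicity. *)

Definition nonneg_partition_of (m : nat) (p : {mset nat}) : Prop :=
  \sum_(j <- p) j = m.

Definition partition_of (m : nat) (p : {mset nat}) : Prop :=
  nonneg_partition_of m p /\ (forall j, j \in p -> 0 < j).

Definition largest_part (p : {mset nat}) (k : nat) : Prop :=
  k \in p /\ (forall j, j \in p -> j <= k).

Definition smallest_part (p : {mset nat}) (k : nat) : Prop :=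
  k \in p /\ (forall j, j \in p -> k <= j).

Definition partitionsA (m : nat) : set {mset nat} :=
  [set p | partition_of m p /\ (forall j, p j <= 1)].

Definition partitionsB (m : nat) : set {mset nat} :=
  [set p | partition_of m p /\ (forall j, j \in p -> odd j)].

Definition partitionsC (m : nat) : set {mset nat} :=
  [set p | partition_of m p /\
    exists N, largest_part p (2 * N) /\ (forall j, 1 <= j <= N -> p j <= 1)].

Definition partitionsD (m : nat) : set {mset nat} :=
  [set p | nonneg_partition_of m p /\
    exists s, [/\ smallest_part p s, p s = 2
                & forall j, j != s -> p j <= 1]].

(* fset_set sends infinite sets to fset0; the four families are shown to be
   finite below, so these are genuine cardinalities. *)
Definition A (m : nat) : nat := #|` fset_set (partitionsA m)|.
Definition B (m : nat) : nat := #|` fset_set (partitionsB m)|.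
Definition C (m : nat) : nat := #|` fset_set (partitionsC m)|.
Definition D (m : nat) : nat := #|` fset_set (partitionsD m)|.

Lemma leq_part_sum (p : {mset nat}) (j : nat) : j \in p -> j <= \sum_(i <- p) i.
Proof.
have -> : (j \in p) = (j \in (p : seq nat)) by [].
elim: (p : seq nat) => // a s IHs; rewrite inE big_cons.
by move=> /orP[/eqP->|/IHs]; [exact: leq_addr|move/leq_trans; apply; exact: leq_addl].
Qed.

Lemma finite_nonneg_partitions (m k : nat) :
  finite_set [set p | nonneg_partition_of m p /\ p 0 <= k].
Proof.
pose f (t : (m + k).-bseq 'I_m.+1) : {mset nat} := seq_mset (map val t).
apply: (@sub_finite_set _ _ (range f)); last exact/finite_image/finite_finset.
move=> p [pm pk].
have szp : size p <= m + k.
  rewrite -(count_predC (pred1 0) p) addnC; apply: leq_add.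
    rewrite -{}pm -sum1_count; elim: (p : seq nat) => [|a s IHs].
      by rewrite big_nil.
    by rewrite !big_cons /=; case: a => [|a] //=; rewrite addSn add0n ltnS (leq_trans IHs) ?leq_addl.
  by rewrite count_mem_mset.
have szq : size [seq inord j : 'I_m.+1 | j <- p] <= m + k by rewrite size_map.
exists (Bseq szq) => //; rewrite /f /= -map_comp -[RHS]seq_mset_id; congr seq_mset.
rewrite -[RHS]map_id; apply/eq_in_map => j jp /=.
by rewrite inordK // ltnS -pm leq_part_sum.
Qed.

Lemma finite_partitions (m : nat) : finite_set [set p | partition_of m p].
Proof.
apply: sub_finite_set (finite_nonneg_partitions m 0) => p [pm p0].
by split=> //; rewrite leqNgt mset_gt0; apply/negP => /p0.
Qed.

Lemma finite_partitionsA (m : nat) : finite_set (partitionsA m).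
Proof. by apply: sub_finite_set (finite_partitions m) => p []. Qed.

Lemma finite_partitionsB (m : nat) : finite_set (partitionsB m).
Proof. by apply: sub_finite_set (finite_partitions m) => p []. Qed.

Lemma finite_partitionsC (m : nat) : finite_set (partitionsC m).
Proof. by apply: sub_finite_set (finite_partitions m) => p []. Qed.

Lemma finite_partitionsD (m : nat) : finite_set (partitionsD m).
Proof.
apply: sub_finite_set (finite_nonneg_partitions m 2) => p [pm [s [_ ps pj]]].
split=> //; have [e|/pj/leqW //] := eqVneq 0 s; by rewrite [p 0](congr1 p e) ps.
Qed.

(* Main.v *)
Require Import Defs.
From mathcomp Require Import all_boot all_order all_algebra.
From mathcomp Require Import finmap multiset zify.
From mathcomp Require Import boolp classical_sets functions cardinality.

Set Implicit Arguments.
Unset Strict Implicit.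
Unset Printing Implicit Defensive.

Local Open Scope mset_scope.
Local Open Scope nat_scope.

(** All the equalities are proved by explicit bijections, each of which replaces
    some copies of one part by copies of another.

    In terms of generating functions, partitions into odd parts of size at most
    2N are counted by 1 / ((1-q)(1-q^3)...(1-q^(2N-1))). Euler's identity
    1 - q^(2x) = (1 - q^x)(1 + q^x), used for x = 1, ..., N, rewrites this as
    (1+q)...(1+q^N) / ((1-q^(N+1))...(1-q^(2N))), which counts partitions into
    parts of size at most 2N whose parts of size at most N are distinct. One use
    of the identity is a bijection: merge equal parts x in pairs into parts 2x.
    This is possible for x = 1, 2, ..., N in this order because the part 2x is
    still absent when x is treated (merge_unmerge, merge_upto_unmerge_upto).

    A(n) = B(n) is the case of N = n, where the bounds N and 2N constrain nothing
    in a partition of n. For B(n) = C(n+1), classify the partitions of n into odd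
    parts by their largest part 2N-1, and those counted by C by their largest
    part 2N. Removing one largest part leaves in both cases a partition of
    n+1-2N, into odd parts less than 2N in the first case and of the mixed kind
    above in the second, so the same bijection applies (odd_even_largest).

    For D(n+1) = 2A(n), first delete the two zeros where there are any. What
    results is a partition of n+1 into positive parts, distinct except that the
    smallest part s may occur once or twice; the zeros were there exactly when s
    occurs once (drop_zeros). Lowering one copy of s to s-1 then gives a
    partition of n into distinct non-negative parts, and s-1 is its smallest part,
    so that the step can be undone (lower_smallest). Such a partition is a
    partition into distinct positive parts, with or without an additional 0
    (card_distinct_nonneg). *)

(** * Bijections and multisets of parts *)

Definition mutually_inverse {T : Type} (X Y : set T) (f g : T -> T) : Prop :=
  (forall p, X p -> Y (f p) /\ g (f p) = p) /\
  (forall q, Y q -> X (g q) /\ f (g q) = q).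

Lemma mutually_inverse_comp (T : Type) (X Y Z : set T) (f g f' g' : T -> T) :
  mutually_inverse X Y f g -> mutually_inverse Y Z f' g' ->
  mutually_inverse X Z (f' \o f) (g \o g').
Proof.
move=> [fX gY] [fY gZ]; split=> [p /fX[/fY[? e] ?]|q /gZ[/gY[? e] ?]] /=.
  by rewrite e.
by rewrite e.
Qed.

Lemma mutually_inverse_sym (T : Type) (X Y : set T) (f g : T -> T) :
  mutually_inverse X Y f g -> mutually_inverse Y X g f.
Proof. by case. Qed.

(** A union of bijections is a bijection when the pieces are disjoint on both
    sides; disjointness is given by functions kX and kY that read off the index
    of the piece, which also serve to select the map to apply. *)
Lemma mutually_inverse_bigcup (T : Type) (X Y : nat -> set T)
    (f g : nat -> T -> T) (kX kY : T -> nat) :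
  (forall i p, X i p -> kX p = i) -> (forall i q, Y i q -> kY q = i) ->
  (forall i, mutually_inverse (X i) (Y i) (f i) (g i)) ->
  mutually_inverse [set p | exists i, X i p] [set q | exists i, Y i q]
    (fun p => f (kX p) p) (fun q => g (kY q) q).
Proof.
move=> XE YE fg; split=> p [i ip].
  rewrite (XE i p ip); have [/(_ p ip)[Yp e] _] := fg i.
  by split; [exists i|rewrite (YE i _ Yp)].
rewrite (YE i p ip); have [_ /(_ p ip)[Xp e]] := fg i.
by split; [exists i|rewrite (XE i _ Xp)].
Qed.

Lemma card_mutually_inverse (T : choiceType) (X Y : set T) (f g : T -> T) :
  finite_set X -> mutually_inverse X Y f g ->
  #|` fset_set X| = #|` fset_set Y|.
Proof.
move=> Xfin [fX gY].
have -> : Y = [set f p | p in X]%classic.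
  apply/seteqP; split=> [q /gY[Xq e]|_ [p Xp <-]]; first by exists (g q).
  exact: (fX p Xp).1.
rewrite fset_set_image // card_in_imfset // => p q.
rewrite !in_fset_set // !inE => /fX[_ {2}<-] /fX[_ {2}<-].
by move=> ->.
Qed.

Lemma sum_msetD (p q : {mset nat}) :
  \sum_(j <- (p `+` q)%mset) j = \sum_(j <- p) j + \sum_(j <- q) j.
Proof.
rewrite -big_cat; apply: perm_big; apply/allP => j _ /=.
by rewrite count_cat !count_mem_mset msetE2.
Qed.

Lemma sum_msetn (k a : nat) : \sum_(j <- msetn k a) j = k * a.
Proof. by rewrite enum_msetn big_nseq iter_addn_0 mulnC. Qed.

Definition replace (p : {mset nat}) (a k b l : nat) : {mset nat} :=
  ((p `\` msetn k a) `+` msetn l b)%mset.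

Lemma replaceE (p : {mset nat}) a k b l j :
  replace p a k b l j =
  p j - (if j == a then k else 0) + (if j == b then l else 0).
Proof. by rewrite /replace !msetE2 !msetnE. Qed.

Lemma sum_replace (p : {mset nat}) a k b l : k <= p a ->
  \sum_(j <- replace p a k b l) j + k * a = \sum_(j <- p) j + l * b.
Proof.
move=> kp; rewrite sum_msetD sum_msetn addnAC; congr (_ + _).
rewrite -(sum_msetn k) -sum_msetD msetBDK //.
by apply/msubsetP => j; rewrite msetnE; case: eqP => // ->.
Qed.

Lemma sum_replace_balanced (p : {mset nat}) a k b l m :
  k <= p a -> k * a = l * b ->
  nonneg_partition_of m p -> nonneg_partition_of m (replace p a k b l).
Proof.
rewrite /nonneg_partition_of => kp e <-; apply/eqP.
by rewrite -(eqn_add2r (k * a)) sum_replace // e.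
Qed.

Lemma leq_part (p : {mset nat}) j : 0 < p j -> j <= \sum_(i <- p) i.
Proof. by rewrite mset_gt0; apply: leq_part_sum. Qed.

Lemma exists_part (p : {mset nat}) : 0 < \sum_(j <- p) j -> exists j, 0 < p j.
Proof.
case ep: (enum_mset p) => [|a s]; first by rewrite big_nil.
by move=> _; exists a; rewrite mset_gt0 -[_ \in p]/(a \in enum_mset p) ep mem_head.
Qed.

Lemma exists_largest_part (p : {mset nat}) :
  0 < \sum_(j <- p) j -> exists k, largest_part p k.
Proof.
move=> /exists_part exp.
case: (ex_maxnP exp (fun j => @leq_part p j)) => k kp kmax; exists k.
by split=> [|j]; rewrite -mset_gt0 // => /kmax.
Qed.

Lemma exists_smallest_part (p : {mset nat}) :
  0 < \sum_(j <- p) j -> exists k, smallest_part p k.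
Proof.
move=> /exists_part exp; case: (ex_minnP exp) => k kp kmin; exists k.
by split=> [|j]; rewrite -mset_gt0 // => /kmin.
Qed.

Definition maxpart (p : {mset nat}) : nat := xget 0 (largest_part p).
Definition minpart (p : {mset nat}) : nat := xget 0 (smallest_part p).

Lemma maxpartE p k : largest_part p k -> maxpart p = k.
Proof.
move=> pk; apply: xget_unique => // l [lp lmax]; case: pk => kp kmax.
by apply/eqP; rewrite eqn_leq lmax // kmax.
Qed.

Lemma minpartE p k : smallest_part p k -> minpart p = k.
Proof.
move=> pk; apply: xget_unique => // l [lp lmin]; case: pk => kp kmin.
by apply/eqP; rewrite eqn_leq lmin // kmin.
Qed.

(** * From odd parts to distinct small parts *)

(** The state of the pairwise merging after x = 1, ..., N have been treated: sizes
    up to N are distinct, and an even part can only have arisen as 2x with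
    x <= N. The bound L on the parts is preserved once 2 * N <= L. *)
Definition mixed (N L m : nat) : set {mset nat} :=
  [set p | nonneg_partition_of m p /\ forall j,
    [/\ 0 < p j -> 0 < j <= L, 0 < p j -> ~~ odd j -> j <= 2 * N
      & 0 < j <= N -> p j <= 1]].

Definition merge_pairs (x : nat) (p : {mset nat}) : {mset nat} :=
  replace p x (2 * (p x)./2) (2 * x) (p x)./2.

Definition unmerge_pairs (x : nat) (p : {mset nat}) : {mset nat} :=
  replace p (2 * x) (p (2 * x)) x (2 * p (2 * x)).

(** Before the step no part equals 2N+2, so the number of these parts afterwards
    is the number of pairs that were merged; the parity of the former
    multiplicity of N+1 is what remains of it. *)
Lemma merge_unmerge N L m : 2 * N.+1 <= L ->
  mutually_inverse (mixed N L m) (mixed N.+1 L m) (merge_pairs N.+1) (unmerge_pairs N.+1).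
Proof.
move=> NL; split=> p [pm Hp].
- have px0 : p (2 * N.+1) = 0.
    by case: (Hp (2 * N.+1)) => _ H _; apply/eqP; rewrite -leqn0 leqNgt; apply/negP => /H; lia.
  split; first split.
  + by apply: sum_replace_balanced pm; lia.
  + move=> j; rewrite replaceE; case: (Hp j).
    by case: (eqVneq j N.+1) => [->|?]; case: eqVneq => ? H1 H2 H3; split; lia.
  + apply/msetP => j; rewrite /unmerge_pairs !replaceE !eqxx px0.
    have [->|?] := eqVneq j N.+1; first by case: eqP; lia.
    by have [->|?] := eqVneq j (2 * N.+1); rewrite ?px0; lia.
- set c := p (2 * N.+1).
  have px1 : p N.+1 <= 1 by case: (Hp N.+1) => _ _; apply; lia.
  split; first split.
  + by apply: sum_replace_balanced pm; rewrite // mulnCA mulnA.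
  + move=> j; rewrite replaceE -/c; case: (Hp j).
    by case: (eqVneq j (2 * N.+1)) => [->|?]; case: eqVneq => ? H1 H2 H3; split; lia.
  + apply/msetP => j; rewrite /merge_pairs !replaceE eqxx -/c.
    have -> : (N.+1 == 2 * N.+1) = false by lia.
    have -> : (p N.+1 - 0 + 2 * c)./2 = c by lia.
    have [->|?] := eqVneq j N.+1; first by case: eqP; lia.
    by have [->|?] := eqVneq j (2 * N.+1); rewrite -/c; lia.
Qed.

Fixpoint merge_upto (N : nat) (p : {mset nat}) : {mset nat} :=
  if N is N'.+1 then merge_pairs N (merge_upto N' p) else p.

Fixpoint unmerge_upto (N : nat) (p : {mset nat}) : {mset nat} :=
  if N is N'.+1 then unmerge_upto N' (unmerge_pairs N p) else p.

Lemma merge_upto_unmerge_upto N L m : 2 * N <= L ->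
  mutually_inverse (mixed 0 L m) (mixed N L m) (merge_upto N) (unmerge_upto N).
Proof.
elim: N => [|N IH] NL; first by split.
by apply: mutually_inverse_comp (merge_unmerge m NL); apply: IH; lia.
Qed.

(** Parts of a partition of n are at most n, so a bound such as 2n is harmless,
    and distinctness up to n is distinctness. *)
Lemma partitionsB_mixed n : partitionsB n = mixed 0 (2 * n) n.
Proof.
apply/seteqP; split=> p.
- move=> [[pn p0] podd]; split=> // j; have := @leq_part p j; rewrite pn mset_gt0.
  split; [move=> pj; have := p0 j pj; lia|move=> /podd ->//|lia].
- move=> [pn Hp]; split; first split=> // j.
    by rewrite -mset_gt0; case: (Hp j) => H _ _ /H /andP[].
  by move=> j; rewrite -mset_gt0; case: (Hp j) => H1 H2 _ pj; move: (H1 pj) (H2 pj); lia.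
Qed.

Lemma partitionsA_mixed n : partitionsA n = mixed n (2 * n) n.
Proof.
apply/seteqP; split=> p.
- move=> [[pn p0] p1]; split=> // j; have := @leq_part p j; have := p1 j.
  rewrite pn mset_gt0; split=> //; [move=> pj; have := p0 j pj; lia|lia].
- move=> [pn Hp]; have p0 j : 0 < p j -> 0 < j by case: (Hp j) => H _ _ /H /andP[].
  split; first by split=> // j; rewrite -mset_gt0; apply: p0.
  move=> j; case: (Hp j) => _ _ H; have := p0 j; have := @leq_part p j.
  by rewrite pn; lia.
Qed.

Lemma card_A_B n : A n = B n.
Proof.
rewrite /A /B partitionsB_mixed partitionsA_mixed; apply/esym.
apply: (card_mutually_inverse _ (merge_upto_unmerge_upto _ (leqnn _))).
by rewrite -partitionsB_mixed; apply: finite_partitionsB.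
Qed.

(** * Trading the largest part 2N - 1 for 2N *)

Definition remove_part (a : nat) (p : {mset nat}) : {mset nat} := replace p a 1 0 0.
Definition add_part (a : nat) (p : {mset nat}) : {mset nat} := replace p 0 0 a 1.

Lemma remove_partE a (p : {mset nat}) j : remove_part a p j = p j - (j == a).
Proof. by rewrite replaceE; do 2 case: eqP; lia. Qed.

Lemma add_partE a (p : {mset nat}) j : add_part a p j = p j + (j == a).
Proof. by rewrite replaceE; do 2 case: eqP; lia. Qed.

Lemma remove_partK a (p : {mset nat}) : 0 < p a -> add_part a (remove_part a p) = p.
Proof.
move=> pa; apply/msetP => j; rewrite add_partE remove_partE.
by case: eqP => [->|]; lia.
Qed.

Lemma add_partK a (p : {mset nat}) : remove_part a (add_part a p) = p.
Proof. by apply/msetP => j; rewrite remove_partE add_partE addnK. Qed.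

Lemma sum_add_part a (p : {mset nat}) : \sum_(j <- add_part a p) j = \sum_(j <- p) j + a.
Proof. by have := @sum_replace p 0 0 a 1 isT; rewrite /add_part; lia. Qed.

Lemma sum_remove_part a (p : {mset nat}) : 0 < p a ->
  \sum_(j <- remove_part a p) j = \sum_(j <- p) j - a.
Proof. by move=> /(@sum_replace p a 1 0 0); rewrite /remove_part; lia. Qed.

Definition odd_largest n N : set {mset nat} :=
  [set p | partitionsB n p /\ largest_part p (2 * N).-1].

Definition even_largest n N : set {mset nat} :=
  [set p | [/\ partition_of n p, largest_part p (2 * N)
             & forall j, 1 <= j <= N -> p j <= 1]].

Lemma odd_largest_remove m N : 0 < N ->
  mutually_inverse (odd_largest (m + (2 * N).-1) N) (mixed 0 (2 * N) m)
    (remove_part (2 * N).-1) (add_part (2 * N).-1).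
Proof.
move=> N0; split=> p.
- move=> [[[pm p0] podd] []]; rewrite -mset_gt0 => kp kmax; split; last exact: remove_partK.
  split; first by rewrite /nonneg_partition_of sum_remove_part // pm addnK.
  move=> j; rewrite remove_partE; have := p0 j; have := podd j; have := kmax j.
  by rewrite -mset_gt0; case: (odd j); split; lia.
- move=> [pm Hp]; split; last exact: add_partK.
  have H j : 0 < add_part (2 * N).-1 p j -> [/\ 0 < j, odd j & j <= (2 * N).-1].
    rewrite add_partE; case: (Hp j); have [->|?] := eqVneq j (2 * N).-1; by split; lia.
  split; [split; [split|]|split].
  + by rewrite /nonneg_partition_of sum_add_part pm.
  + by move=> j; rewrite -mset_gt0 => /H[].
  + by move=> j; rewrite -mset_gt0 => /H[].
  + by rewrite -mset_gt0 add_partE eqxx; lia.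
  + by move=> j; rewrite -mset_gt0 => /H[].
Qed.

Lemma even_largest_remove m N : 0 < N ->
  mutually_inverse (even_largest (m + 2 * N) N) (mixed N (2 * N) m)
    (remove_part (2 * N)) (add_part (2 * N)).
Proof.
move=> N0; split=> p.
- move=> [[pm p0] []]; rewrite -mset_gt0 => kp kmax p1; split; last exact: remove_partK.
  split; first by rewrite /nonneg_partition_of sum_remove_part // pm addnK.
  move=> j; rewrite remove_partE; have := p0 j; have := p1 j; have := kmax j.
  by rewrite -mset_gt0; split; lia.
- move=> [pm Hp]; split; last exact: add_partK.
  have H j : 0 < add_part (2 * N) p j -> 0 < j <= 2 * N.
    by rewrite add_partE; case: (Hp j); have [->|?] := eqVneq j (2 * N); lia.
  split; [split|split|].
  + by rewrite /nonneg_partition_of sum_add_part pm.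
  + by move=> j; rewrite -mset_gt0 => /H/andP[].
  + by rewrite -mset_gt0 add_partE eqxx; lia.
  + by move=> j; rewrite -mset_gt0 => /H/andP[].
  + by move=> j jN; rewrite add_partE; case: (Hp j) => _ _; case: eqP; lia.
Qed.

(** Deleting 2N-1 from n and 2N from n+1 leaves the same total, so merging pairs
    connects the two sides. For N = 0 and for 2N > n+1 both sides are empty. *)
Lemma odd_even_largest n N :
  mutually_inverse (odd_largest n N) (even_largest n.+1 N)
    (add_part (2 * N) \o (merge_upto N \o remove_part (2 * N).-1))
    ((add_part (2 * N).-1 \o unmerge_upto N) \o remove_part (2 * N)).
Proof.
have [/andP[N0 Nn]|outN] := boolP (0 < 2 * N <= n.+1).
  have {}N0 : 0 < N by lia.
  have en : n = (n.+1 - 2 * N) + (2 * N).-1 by lia.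
  have en1 : n.+1 = (n.+1 - 2 * N) + 2 * N by lia.
  apply: mutually_inverse_comp (_ : mutually_inverse _ (mixed N (2 * N) (n.+1 - 2 * N)) _ _) _.
    rewrite [X in odd_largest X]en.
    exact: mutually_inverse_comp (odd_largest_remove _ N0) (merge_upto_unmerge_upto _ (leqnn _)).
  rewrite {2}en1; apply: mutually_inverse_sym; exact: even_largest_remove.
split=> p.
  move=> [[[pn p0] podd] [kp _]]; have := leq_part_sum kp; have := p0 _ kp.
  by rewrite pn; lia.
move=> [[pn p0] [kp _] _]; have := leq_part_sum kp; have := p0 _ kp.
by rewrite pn; lia.
Qed.

Lemma card_B_C n : 0 < n -> B n = C n.+1.
Proof.
move=> n0; rewrite /B /C.
have -> : partitionsC n.+1 = [set p | exists N, even_largest n.+1 N p]%classic.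
  apply/seteqP; split=> p [pn []]; first by move=> N [? ?]; exists N.
  by move=> ? ?; split=> //; exists pn.
have -> : partitionsB n = [set p | exists N, odd_largest n N p]%classic.
  apply/seteqP; split=> p; last by case=> N [].
  move=> Bp; have [[pn _] podd] := Bp; have /exists_largest_part[k pk] :
    0 < \sum_(j <- p) j by rewrite pn.
  have [kp _] := pk; have kodd := podd k kp.
  (* k is odd, so k = 2N - 1 with N = (k + 1) / 2 *)
  by exists (k.+1)./2; split=> //; have -> : (2 * k.+1./2).-1 = k by lia.
apply: card_mutually_inverse (mutually_inverse_bigcup
  (kX := fun p => (maxpart p).+1./2) (kY := fun p => (maxpart p)./2)
  _ _ (odd_even_largest n)).
- apply: sub_finite_set (finite_partitionsB n) => p [N []] //.
- move=> N p [[[_ p0] _] pk]; rewrite (maxpartE pk); have [/p0 kp _] := pk; lia.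
- by move=> N q [_ /maxpartE -> _]; lia.
Qed.

(** * Two copies of the smallest part *)

(** What the partitions counted by D become once their zeros are deleted, whether
    their repeated smallest part was zero or positive. *)
Definition low_pair m : set {mset nat} :=
  [set p | nonneg_partition_of m p /\ exists s,
    [/\ 0 < s, smallest_part p s, p s <= 2 & forall j, j != s -> p j <= 1]].

Definition distinct_nonneg n : set {mset nat} :=
  [set p | nonneg_partition_of n p /\ forall j, p j <= 1].

(** Whether two zeros were dropped can be read off the result: the smallest part
    occurs twice exactly when there were none. Positivity of m ensures that a
    smallest part remains once the zeros are gone. *)
Lemma drop_zeros m : 0 < m ->
  mutually_inverse (partitionsD m) (low_pair m)
    (fun p => replace p 0 (p 0) 0 0)
    (fun q => if q (minpart q) == 2 then q else replace q 0 0 0 2).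
Proof.
move=> m0; split=> p [pm [s]].
- move=> [ps ps2 p1]; have [s_eq0|s_neq0] := eqVneq s 0.
    rewrite {s}s_eq0 in ps ps2 p1.
    set q := replace p 0 (p 0) 0 0.
    have qE j : q j = if j == 0 then 0 else p j.
      by rewrite /q replaceE; have [->|?] := eqVneq j 0; lia.
    have qm : nonneg_partition_of m q by apply: sum_replace_balanced pm; rewrite ?muln0.
    have [|t qt] := @exists_smallest_part q; first by rewrite qm.
    have t0 : t != 0 by case: qt; rewrite -mset_gt0 qE; case: eqP.
    have qt1 : q t <= 1 by rewrite qE (negbTE t0) p1.
    split.
      split=> //; exists t; split=> //; first by rewrite lt0n.
      - exact: leqW.
      - by move=> j _; rewrite qE; case: eqP => // /eqP; exact: p1.
    rewrite (minpartE qt); have -> : (q t == 2) = false by lia.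
    by apply/msetP => j; rewrite replaceE qE; have [->|?] := eqVneq j 0; lia.
  have p0 : p 0 = 0.
    by case: ps => _ /(_ 0); rewrite -mset_gt0; lia.
  have -> : replace p 0 (p 0) 0 0 = p.
    by apply/msetP => j; rewrite p0 replaceE; case: eqP; lia.
  rewrite (minpartE ps) ps2 eqxx; split=> //; split=> //.
  by exists s; rewrite ps2 lt0n.
- move=> [s0 ps ps2 p1]; rewrite (minpartE ps).
  have p0 : p 0 = 0.
    by case: ps => _ /(_ 0); rewrite -mset_gt0; lia.
  case: eqP => [e|/eqP e].
    split; first by split=> //; exists s.
    by apply/msetP => j; rewrite p0 replaceE; case: eqP; lia.
  set q := replace p 0 0 0 2.
  have qE j : q j = if j == 0 then 2 else p j.
    by rewrite /q replaceE; have [->|?] := eqVneq j 0; lia.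
  split; last first.
    by apply/msetP => j; rewrite replaceE !qE eqxx; have [->|?] := eqVneq j 0; rewrite ?p0; lia.
  split; first by apply: sum_replace_balanced pm.
  exists 0; split; [split=> //|by []|].
    by rewrite -mset_gt0 qE.
  move=> j j0; rewrite qE (negbTE j0); have [->|/p1 //] := eqVneq j s; lia.
Qed.

(** A smallest part s > 0 occurring once or twice leaves at most one copy of s
    after one copy is lowered, and s-1 was absent; conversely, raising the
    smallest part t of distinct parts creates at most one repetition, of t+1,
    which is then the smallest part. *)
Lemma lower_smallest n : 0 < n ->
  mutually_inverse (low_pair n.+1) (distinct_nonneg n)
    (fun p => replace p (minpart p) 1 (minpart p).-1 1)
    (fun q => replace q (minpart q) 1 (minpart q).+1 1).
Proof.
move=> n0; split=> p.
- move=> [pn [s [s0 ps ps2 p1]]]; rewrite (minpartE ps).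
  have [sp smin] := ps; rewrite -mset_gt0 in sp.
  set q := replace p s 1 s.-1 1.
  have qE j : q j = p j - (j == s) + (j == s.-1).
    by rewrite /q replaceE; do 2 case: eqP.
  have ps1 : p s.-1 = 0 by have := smin s.-1; rewrite -mset_gt0; lia.
  have qs : smallest_part q s.-1.
    split=> [|j]; rewrite -mset_gt0 qE; first by rewrite eqxx; lia.
    by have := smin j; rewrite -mset_gt0; lia.
  split; first split.
  + have := sum_replace s.-1 1 sp; rewrite pn -/q /nonneg_partition_of; lia.
  + move=> j; rewrite qE; have [->|/p1] := eqVneq j s; first by lia.
    by have [->|?] := eqVneq j s.-1; lia.
  + rewrite (minpartE qs) prednK //; apply/msetP => j; rewrite replaceE qE.
    have [->|?] := eqVneq j s; first by case: eqP; lia.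
    by have [->|?] := eqVneq j s.-1; lia.
- move=> [pn p1]; have [|t pt] := @exists_smallest_part p; first by rewrite pn.
  rewrite (minpartE pt); have [tp tmin] := pt; rewrite -mset_gt0 in tp.
  set q := replace p t 1 t.+1 1.
  have qE j : q j = p j - (j == t) + (j == t.+1).
    by rewrite /q replaceE; do 2 case: eqP.
  have pt1 := p1 t.
  have qt : smallest_part q t.+1.
    split=> [|j]; rewrite -mset_gt0 qE; first by rewrite eqxx; lia.
    have := tmin j; rewrite -mset_gt0.
    by have [->|?] := eqVneq j t; lia.
  split; first split.
  + have := sum_replace t.+1 1 tp; rewrite pn -/q /nonneg_partition_of; lia.
  + exists t.+1; split=> // [|j /negbTE jt]; rewrite qE.
      by have := p1 t.+1; rewrite eqxx; lia.
    by rewrite jt; have := p1 j; lia.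
  + rewrite (minpartE qt) /=; apply/msetP => j; rewrite replaceE qE.
    have [->|?] := eqVneq j t; first by case: eqP; lia.
    by case: eqP; lia.
Qed.

Lemma finite_distinct_nonneg n : finite_set (distinct_nonneg n).
Proof. by apply: sub_finite_set (finite_nonneg_partitions n 1) => p []. Qed.

(** The multiplicity of 0 is either 0 or 1, and 0 does not contribute to the sum;
    each of the two classes is a copy of the partitions into distinct parts. *)
Lemma card_distinct_nonneg n : #|` fset_set (distinct_nonneg n)| = 2 * A n.
Proof.
set Z : set {mset nat} := [set p | distinct_nonneg n p /\ p 0 = 1]%classic.
have part0 p : partition_of n p -> p 0 = 0.
  by move=> [_ /(_ 0)]; rewrite -mset_gt0; lia.
have AZ : mutually_inverse (partitionsA n) Z (add_part 0) (remove_part 0).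
  split=> p.
  - move=> [pn p1]; have p0 := part0 p pn; split; last exact: add_partK.
    split; last by rewrite add_partE p0.
    split; first by rewrite /nonneg_partition_of sum_add_part addn0 pn.1.
    by move=> j; rewrite add_partE; have [->|?] := eqVneq j 0; rewrite ?p0 ?addn0.
  - move=> [[pn p1] p0]; split; last by rewrite remove_partK ?p0.
    split; last by move=> j; rewrite remove_partE; have := p1 j; lia.
    split; first by rewrite /nonneg_partition_of sum_remove_part ?p0 // subn0.
    by move=> j; rewrite -mset_gt0 remove_partE lt0n; have [->|//] := eqVneq j 0; lia.
have Zfin : finite_set Z.
  by apply: sub_finite_set (finite_distinct_nonneg n) => p [].
have Afin := finite_partitionsA n.
have -> : distinct_nonneg n = (partitionsA n `|` Z)%classic.
  apply/seteqP; split=> p; last by move=> [[[]]|[]].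
  move=> [pn p1]; have := p1 0; rewrite leq_eqVlt => /orP[/eqP p0|p0]; first by right.
  left; split=> //; split=> // j; rewrite -mset_gt0 [0 < j]lt0n.
  by have [->|//] := eqVneq j 0; lia.
rewrite fset_setU // cardfsU [X in _ - X](_ : _ = 0) ?subn0.
  by rewrite /A -(card_mutually_inverse Afin AZ) mul2n addnn.
apply/eqP; rewrite cardfs_eq0 -fset_setI //; apply/eqP.
rewrite (_ : (_ `&` _)%classic = set0) ?fset_set0 //.
by apply/seteqP; split=> p // [[/part0 p0 _] [_]]; rewrite p0.
Qed.

Lemma card_D_A n : 0 < n -> D n.+1 = 2 * A n.
Proof.
move=> n0; rewrite -card_distinct_nonneg /D.
apply: card_mutually_inverse (finite_partitionsD _) _.
exact: mutually_inverse_comp (drop_zeros _) (lower_smallest n0).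
Qed.

Theorem theorem1p1 (n : nat) (hn : 0 < n) :
  [/\ A n = B n, B n = C n.+1
    & ((C n.+1)%:R = 1 / 2 * (D n.+1)%:R :> rat)%R].
Proof.
have BC := card_B_C hn; split=> //; first exact: card_A_B.
rewrite (card_D_A hn) card_A_B BC GRing.natrM GRing.mulrA.
by rewrite GRing.divfK ?GRing.mul1r.
Qed.
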